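(* Let $\mathcal{M}$ be a 6-orbit map whose truncation $\mathrm{Tr}(\mathcal{M})$ is a 9-orbit map. Then one of the following holds. (i) $\mathcal{M}$ is of type $6_D$ and $\mathrm{Tr}(\mathcal{M})$ is of type $9_A$; (ii) $\mathcal{M}$ is of type $6_F$ and $\mathrm{Tr}(\mathcal{M})$ is of type $9_B$; (iii) $\mathcal{M}$ is of type $6_{M_{opp}}$ and $\mathrm{Tr}(\mathcal{M})$ is of type $9_{C_d}$.
   Context: A map $\mathcal{M}$ is a 2-cell embedding of a connected graph on a surface. Its flags are the triangles of the barycentric subdivision of $\mathcal{M}$, each identified with a triple $(\Phi_0,\Phi_1,\Phi_2)$ of a mutually incident vertex, edge and face; $\mathcal{F}(\mathcal{M})$ is the set of flags. For $i\in\{0,1,2\}$ let $s_i$ be the permutation of $\mathcal{F}(\mathcal{M})$ (acting on the right) sending each flag $\Phi$ to its $i$-adjacent flag $\Phi^{s_i}=\Phi^i$ (the neighbouring triangle differing from $\Phi$ only in the entry $\Phi_i$). The $s_i$ are fixed-point free involutions, $s_0s_2=s_2s_0$ is a fixed-point free involution, and $\langle s_0,s_1,s_2\rangle$ is transitive on $\mathcal{F}(\mathcal{M})$. The automorphism group $\Gamma(\mathcal{M})$ is (identified with) the group of permutations of $\mathcal{F}(\mathcal{M})$ commuting with $s_0,s_1,s_2$; it acts freely on flags. $\mathcal{M}$ is a $k$-orbit map if $\Gamma(\mathcal{M})$ has exactly $k$ orbits on $\mathcal{F}(\mathcal{M})$. The $s_i$ act on the set $\mathrm{Orb}(\mathcal{M})$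 of flag-orbits by $\mathcal{O}_\Phi\cdot s_i=\mathcal{O}_{\Phi^{s_i}}$. Symmetry type graph: $T(\mathcal{M})$ has vertex set $\mathrm{Orb}(\mathcal{M})$, with an edge of colour $i$ joining two distinct orbits interchanged by $s_i$, and a semi-edge of colour $i$ at each orbit fixed by $s_i$. A type with $k$ vertices is given below by a triple $(\sigma_0,\sigma_1,\sigma_2)$ of permutations of $\{1,\dots,k\}$ in cycle notation: $\mathcal{M}$ is of that type iff there is a bijection $\mathrm{Orb}(\mathcal{M})\to\{1,\dots,k\}$ carrying the action of $s_i$ to $\sigma_i$ for $i=0,1,2$. (For $\mathrm{Tr}(\mathcal{M})$, the involutions $r_i$ below play the role of $s_i$.) Truncation: $\mathrm{Tr}(\mathcal{M})$ is the map on the same surface with flag set $\mathcal{F}(\mathcal{M})\times\{0,1,2\}$ and flag adjacencies $r_0,r_1,r_2$ given by $(\Phi,0)r_0=(\Phi^{s_1},0)$, $(\Phi,0)r_1=(\Phi^{s_2},0)$, $(\Phi,0)r_2=(\Phi,2)$; $(\Phi,1)r_0=(\Phi^{s_0},1)$, $(\Phi,1)r_1=(\Phi,2)$, $(\Phi,1)r_2=(\Phi^{s_2},1)$; $(\Phi,2)r_0=(\Phi^{s_1},2)$, $(\Phi,2)r_1=(\Phi,1)$, $(\Phi,2)r_2=(\Phi,0)$. Types on $\{1,\dots,6\}$: $6_D$: $\sigma_0=(1\,3)(4\,6)$, $\sigma_1=(2\,3)$, $\sigma_2=(1\,4)(2\,5)(3\,6)$. $6_F$: $\sigma_0=(1\,2)(5\,6)$,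 $\sigma_1=(2\,3)(5\,6)$, $\sigma_2=(1\,5)(2\,6)(3\,4)$. $6_{M_{opp}}$: $\sigma_0=(1\,3)(4\,6)$, $\sigma_1=(2\,3)(5\,6)$, $\sigma_2=(1\,6)(3\,4)(2\,5)$. Types on $\{1,\dots,9\}$: $9_A$: $\sigma_0=(1\,7)(2\,8)$, $\sigma_1=(1\,6)(2\,3)(4\,5)(8\,9)$, $\sigma_2=(1\,2)(3\,4)(5\,6)(7\,8)$. $9_B$: $\sigma_0=(3\,6)(4\,7)(5\,8)$, $\sigma_1=(2\,3)(5\,6)(8\,9)$, $\sigma_2=(1\,2)(4\,5)(7\,8)$. $9_{C_d}$: $\sigma_0=(1\,7)(2\,8)(3\,4)$, $\sigma_1=(1\,6)(2\,3)(4\,5)(8\,9)$, $\sigma_2=(1\,2)(3\,4)(5\,6)(7\,8)$. *)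

(* Defs.v *)
From mathcomp Require Import all_boot all_fingroup.
From mathcomp Require Import boolp classical_sets functions cardinality.

Set Implicit Arguments.
Unset Strict Implicit.
Unset Printing Implicit Defensive.

Local Open Scope classical_set_scope.
Local Open Scope card_scope.

Notation o0 := (@Ordinal 3 0 isT).
Notation o1 := (@Ordinal 3 1 isT).
Notation o2 := (@Ordinal 3 2 isT).

(* A map is given by its flags (possibly infinitely many) and the adjacencies
   [adj i x] = x^{s_i}. The [adj i] are involutions, so words in them account
   for the whole group <s_0, s_1, s_2>. *)
Record surface_map := SurfaceMap {
  flag :> Type;
  adj : 'I_3 -> flag -> flag;
  flag_inhabited : inhabited flag;
  adjK : forall i, involutive (adj i);
  adj_free : forall i x, adj i x <> x;
  adj02C : forall x, adj o2 (adj o0 x) = adj o0 (adj o2 x);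
  adj02_free : forall x, adj o2 (adj o0 x) <> x;
  adj_trans : forall x y, exists w : seq 'I_3,
    foldl (fun z i => adj i z) x w = y
}.

Definition automorphism (M : surface_map) (g : M -> M) : Prop :=
  bijective g /\ forall i x, g (adj i x) = adj i (g x).

Definition flag_orbit (M : surface_map) (x : M) : set M :=
  [set y | exists2 g : M -> M, automorphism g & y = g x].

Definition Orb (M : surface_map) : set (set M) := range (@flag_orbit M).
Arguments Orb M : clear implicits.

Definition orbit_map (k : nat) (M : surface_map) : Prop := Orb M #= `I_k.

Definition of_type (k : nat) (M : surface_map) (sigma : 'I_3 -> 'S_k) : Prop :=
  exists f : set M -> 'I_k, set_bij (Orb M) [set: 'I_k] f /\
    forall i (x : M), f (flag_orbit (adj i x)) = sigma i (f (flag_orbit x)).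

Definition trunc_adj (M : surface_map) (i : 'I_3) (x : M * 'I_3) : M * 'I_3 :=
  let: (Phi, j) := x in
  match val j, val i with
  | 0, 0 => (adj o1 Phi, o0) | 0, 1 => (adj o2 Phi, o0) | 0, _ => (Phi, o2)
  | 1, 0 => (adj o0 Phi, o1) | 1, 1 => (Phi, o2) | 1, _ => (adj o2 Phi, o1)
  | _, 0 => (adj o1 Phi, o2) | _, 1 => (Phi, o1) | _, _ => (Phi, o0)
  end.

Lemma ord3P (P : 'I_3 -> Prop) : P o0 -> P o1 -> P o2 -> forall i, P i.
Proof.
by move=> P0 P1 P2 [[|[|[|//]]] lti]; rewrite (bool_irrelevance lti isT).
Qed.

Section Truncation.
Variable M : surface_map.

Lemma trunc_inhabited : inhabited (M * 'I_3).
Proof. by case: (flag_inhabited M) => x; exists; exact: (x, o0). Qed.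

Lemma trunc_adjK (i : 'I_3) : involutive (@trunc_adj M i).
Proof. by elim/ord3P: i => -[x j]; elim/ord3P: j => //=; rewrite adjK. Qed.

Lemma trunc_adj_free (i : 'I_3) (x : M * 'I_3) : trunc_adj i x <> x.
Proof.
case: x => x j; elim/ord3P: i; elim/ord3P: j => //= -[];
  exact: adj_free.
Qed.

Lemma trunc_adj02C (x : M * 'I_3) :
  trunc_adj o2 (trunc_adj o0 x) = trunc_adj o0 (trunc_adj o2 x).
Proof. by case: x => x j; elim/ord3P: j => //=; rewrite adj02C. Qed.

Lemma trunc_adj02_free (x : M * 'I_3) : trunc_adj o2 (trunc_adj o0 x) <> x.
Proof. by case: x => x j; elim/ord3P: j => //= -[]; exact: adj02_free. Qed.

Lemma trunc_adj_trans (x y : M * 'I_3) :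
  exists w : seq 'I_3, foldl (fun z i => trunc_adj i z) x w = y.
Proof.
pose reach (x y : M * 'I_3) :=
  exists w : seq 'I_3, foldl (fun z i => trunc_adj i z) x w = y.
have reach_trans u v t : reach u v -> reach v t -> reach u t.
  by move=> [w <-] [w' <-]; exists (w ++ w'); rewrite foldl_cat.
have to0 z j : reach (z, j) (z, o0).
  by elim/ord3P: j; [exists [::] | exists [:: o1; o2] | exists [:: o2]].
have from0 z j : reach (z, o0) (z, j).
  by elim/ord3P: j; [exists [::] | exists [:: o2; o1] | exists [:: o2]].
have step z i : reach (z, o0) (adj i z, o0).
  by elim/ord3P: i; [exists [:: o2; o1; o0; o1; o2] | exists [:: o0] |
                     exists [:: o1]].
case: x y => x j [y k]; apply: (reach_trans _ (x, o0)) => //.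
apply: (reach_trans _ (y, o0)) => //.
have [w <-] := adj_trans x y.
elim: w x => [|i w IHw] x /=; first by exists [::].
exact: (reach_trans _ (adj i x, o0)).
Qed.

Definition Tr : surface_map :=
  SurfaceMap trunc_inhabited trunc_adjK trunc_adj_free trunc_adj02C
    trunc_adj02_free trunc_adj_trans.

End Truncation.

(* The permutation of {1, ..., k+1} that is the product of the listed
   transpositions; the point m is the ordinal of value m - 1. *)
Definition cycles {k : nat} (l : seq (nat * nat)) : 'S_k.+1 :=
  (\prod_(c <- l) tperm (inord c.1.-1) (inord c.2.-1))%g.

Definition triple {k : nat} (a0 a1 a2 : seq (nat * nat))
    (i : 'I_3) : 'S_k.+1 :=
  cycles (nth [::] [:: a0; a1; a2] i).

Definition type6_D : 'I_3 -> 'S_6 := triple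
  [:: (1, 3); (4, 6)]
  [:: (2, 3)]
  [:: (1, 4); (2, 5); (3, 6)].

Definition type6_F : 'I_3 -> 'S_6 := triple
  [:: (1, 2); (5, 6)]
  [:: (2, 3); (5, 6)]
  [:: (1, 5); (2, 6); (3, 4)].

Definition type6_Mopp : 'I_3 -> 'S_6 := triple
  [:: (1, 3); (4, 6)]
  [:: (2, 3); (5, 6)]
  [:: (1, 6); (3, 4); (2, 5)].

Definition type9_A : 'I_3 -> 'S_9 := triple
  [:: (1, 7); (2, 8)]
  [:: (1, 6); (2, 3); (4, 5); (8, 9)]
  [:: (1, 2); (3, 4); (5, 6); (7, 8)].

Definition type9_B : 'I_3 -> 'S_9 := triple
  [:: (3, 6); (4, 7); (5, 8)]
  [:: (2, 3); (5, 6); (8, 9)]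
  [:: (1, 2); (4, 5); (7, 8)].

Definition type9_Cd : 'I_3 -> 'S_9 := triple
  [:: (1, 7); (2, 8); (3, 4)]
  [:: (1, 6); (2, 3); (4, 5); (8, 9)]
  [:: (1, 2); (3, 4); (5, 6); (7, 8)].

(* Main.v *)
Require Import Defs.
From mathcomp Require Import all_boot all_fingroup.
From mathcomp Require Import boolp classical_sets functions cardinality.

Set Implicit Arguments.
Unset Strict Implicit.
Unset Printing Implicit Defensive.

(** An automorphism of [Tr M] that preserves the label in {0, 1, 2} of one flag
    preserves all labels, because adjacencies change labels by fixed
    permutations, and is then induced by an automorphism of [M].  So [(x, j)]
    and [(y, j)] lie in one orbit exactly when [x] and [y] do
    ([meets_same]), and the three labels give three injections of the orbits of
    [M] into those of [Tr M].  All orbits of [Tr M] carry the same number of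
    labels; counting 3 * 6 = 9 * n shows that this number is 2
    ([labels_count]).

    Therefore the orbit of [(x, 0)] has exactly one further label, 1 or 2.  Let
    A be the set of flags for which it is 1.  Following the labels along the
    adjacencies, s_0 and s_1 preserve A while s_2 exchanges A with its
    complement, so A consists of 3 of the 6 orbits.  On these three points
    there are four involutions: a and b induced by s_0 and s_1, t induced by
    s_2 s_1 s_2, and be, which sends x to the y in A such that [(x, 0)] and
    [(s_2 y, 1)] lie in one orbit.  Equivariance gives be b = a be and
    be t = t be, and connectedness of the map makes <a, b, t> transitive.

    If be exchanges p and q and fixes r, then t is trivial or equal to be, and
    transitivity forces a and b to be the two other transpositions.  If be is
    trivial, then a = b and t are distinct transpositions ([three_points]).
    These are the three cases of the conclusion, since a, b, t, be determine
    both orbit graphs: the orbits of [M] are represented by x and s_2 x, and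
    those of [Tr M] by [(x, 0)], [(s_2 x, 0)] and [(x, 1)], for x among the three
    points ([adj_map_flag], [adj_trunc_flag]). *)

(** * Flag-orbits *)

Definition same_orbit (N : surface_map) (x y : N) : Prop :=
  exists2 g : N -> N, automorphism g & y = g x.

Section FlagOrbits.
Variable N : surface_map.
Implicit Types (x y z : N) (i : 'I_3).

Lemma same_refl x : same_orbit x x.
Proof. by exists id => //; split=> //; exists id. Qed.

Lemma same_sym x y : same_orbit x y -> same_orbit y x.
Proof.
move=> [g [[h gK hK] gE] ->]; exists h; last by rewrite gK.
split; first by exists g.
by move=> i z; rewrite -{1}(hK z) -gE gK.
Qed.

Lemma same_trans x y z : same_orbit x y -> same_orbit y z -> same_orbit x z.
Proof.
move=> [g [gB gE] ->] [h [hB hE] ->]; exists (h \o g) => //.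
by split=> [|i w /=]; [exact: bij_comp | rewrite gE hE].
Qed.

Lemma same_adj i x y : same_orbit x y -> same_orbit (adj i x) (adj i y).
Proof. by move=> [g gA ->]; exists g => //; rewrite gA.2. Qed.

Lemma flag_orbit_eqP x y : flag_orbit x = flag_orbit y <-> same_orbit x y.
Proof.
split=> [E|xy]; first by have: flag_orbit y y := same_refl y; rewrite -E.
apply/funext => z; apply/propext; split=> [xz|yz].
  exact: same_trans (same_sym xy) xz.
exact: same_trans xy yz.
Qed.

(** The form in which connectedness of the map is used. *)
Lemma flag_ind (P : N -> Prop) x :
  P x -> (forall i y, P y -> P (adj i y)) -> forall y, P y.
Proof.
move=> Px PA y; have [w <-] := adj_trans x y.
by elim: w x Px => //= i w IHw x Px; apply/IHw/PA.
Qed.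

Lemma orbit_numbering k : orbit_map k N ->
  exists2 cl : N -> 'I_k,
    forall x y, cl x = cl y <-> same_orbit x y & forall m, exists x, cl x = m.
Proof.
move=> /card_set_bijP [f [fS fI fO]].
have fx x : f (flag_orbit x) < k by apply: fS; exists x.
exists (fun x => Ordinal (fx x)) => [x y|m].
  split=> [[] E|/flag_orbit_eqP xy].
    by apply/flag_orbit_eqP; apply: fI => //; rewrite inE; eexists.
  by apply/val_inj; rewrite /= xy.
have [_ [x _ <-] fm] := fO m (ltn_ord m).
by exists x; apply/val_inj.
Qed.

(** Adjacencies already force the listed flags to meet every orbit, because
    words in the adjacencies are transitive; the orbit count then makes the
    listing a bijection. *)
Lemma of_type_flags k (sigma : 'I_3 -> 'S_k) (x : 'I_k -> N) :
    orbit_map k N -> 0 < k ->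
    (forall i m, same_orbit (adj i (x m)) (x (sigma i m))) ->
  of_type N sigma.
Proof.
move=> /orbit_numbering [cl clP clO] k0 xS.
have x_meets y : exists m, same_orbit y (x m).
  move: y; apply: (flag_ind (x := x (Ordinal k0))) => [|i y [m ym]].
    by exists (Ordinal k0); exact: same_refl.
  by exists (sigma i m); apply: same_trans (same_adj i ym) (xS i m).
have /choice [h hK] : forall m, exists n, cl (x n) = m.
  move=> m; have [y <-] := clO m; have [n yn] := x_meets y.
  by exists n; apply/esym/clP.
have [h' h'K hK'] := injF_bij (can_inj (f := h) (g := fun n => cl (x n)) hK).
have x_inj u v : same_orbit (x u) (x v) -> u = v.
  by move=> /clP; rewrite -(hK' u) -(hK' v) !hK => ->.
have /choice [f fP] : forall O : set N, exists m,
    forall y, O = flag_orbit y -> same_orbit y (x m).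
  move=> O; have [[y ->]|nO] := pselect (exists y, O = flag_orbit y).
    have [m ym] := x_meets y; exists m => z /flag_orbit_eqP yz.
    exact: same_trans (same_sym yz) ym.
  by exists (Ordinal k0) => y Oy; case: nO; exists y.
have fE y : same_orbit y (x (f (flag_orbit y))) by exact: fP.
exists f; split=> [|i y].
  split=> // [_ _ /set_mem [y _ <-] /set_mem [z _ <-] E|m _].
    by apply/flag_orbit_eqP; apply: same_trans (fE y) _; rewrite E;
       apply/same_sym.
  exists (flag_orbit (x m)); first by exists (x m).
  by apply/x_inj/same_sym.
apply: x_inj; apply: same_trans (same_sym (fE _)) _.
by apply: same_trans (xS _ _); apply: same_adj.
Qed.

End FlagOrbits.

(** Transpositions acting on bare naturals, so that the permutations of the
    types can be evaluated by computation; points are numbered from 0. *)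
Definition swaps (l : seq (nat * nat)) (m : nat) : nat :=
  foldl (fun v c => if v == c.1.-1 then c.2.-1
                    else if v == c.2.-1 then c.1.-1 else v) m l.

Lemma cyclesE k (l : seq (nat * nat)) (m : 'I_k.+1) :
    all (fun c => (c.1.-1 <= k) && (c.2.-1 <= k)) l ->
  cycles l m = swaps l m :> nat.
Proof.
rewrite /cycles; elim: l m => [|[c d] l IHl] m /=.
  by rewrite big_nil perm1.
move=> /andP[/andP[ck dk] lk]; rewrite big_cons permM IHl //=; congr swaps.
by rewrite permE /= -!val_eqE /= !inordK //; do 2?case: ifP => _; rewrite ?inordK.
Qed.

(** A list of points of a combinatorial model of the orbit graph, in the order
    of the numbering of the type, reduces membership in that type to equalities
    between explicit lists. *)
Lemma of_type_model k (N : surface_map) (Z : Type) (F : Z -> N)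
    (act : 'I_3 -> Z -> Z) (z0 : Z) (zs : seq Z) (a0 a1 a2 : seq (nat * nat)) :
    orbit_map k.+1 N ->
    (forall i z, same_orbit (adj i (F z)) (F (act i z))) ->
    all (fun c => (c.1.-1 <= k) && (c.2.-1 <= k)) (a0 ++ a1 ++ a2) ->
    (forall i : 'I_3, map (act i) zs =
       [seq nth z0 zs (swaps (nth [::] [:: a0; a1; a2] i) m)
          | m <- iota 0 k.+1]) ->
  of_type N (@triple k a0 a1 a2).
Proof.
move=> hN FA; rewrite !all_cat => /and3P[l0 l1 l2] zsE.
apply: (of_type_flags (x := fun m => F (nth z0 zs m)) hN) => // i m.
have zsk : size zs = k.+1.
  by rewrite -(size_map (act o0)) zsE size_map size_iota.
rewrite /triple cyclesE; last by elim/ord3P: i.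
apply: same_trans (FA _ _) _.
have -> : act i (nth z0 zs m) = nth z0 (map (act i) zs) m.
  by rewrite (nth_map z0) // zsk.
rewrite zsE (nth_map 0) ?size_iota // nth_iota //.
exact: same_refl.
Qed.

(** * Labels of flags of the truncation *)

Definition relabel (i j : 'I_3) : 'I_3 :=
  match val i, val j with
  | 1, 1 => o2 | 1, 2 => o1
  | 2, 0 => o2 | 2, 2 => o0
  | _, _ => j
  end.

Lemma relabelK i : involutive (relabel i).
Proof. by elim/ord3P: i; elim/ord3P; apply/val_inj. Qed.

Lemma trunc_adj_label (M : surface_map) i (z : Tr M) :
  (adj i z).2 = relabel i z.2.
Proof. by case: z => x j; elim/ord3P: i; elim/ord3P: j; apply/val_inj. Qed.

(** For [j] and [k] distinct, such a pair witnesses an automorphism of [Tr M]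
    that does not come from [M]. *)
Definition meets (M : surface_map) (x : M) (j : 'I_3) (y : M) (k : 'I_3) : Prop :=
  @same_orbit (Tr M) (x, j) (y, k).

Section TruncationOrbits.
Variable M : surface_map.
Implicit Types (x y : M) (z : Tr M) (i j k : 'I_3).

(** Labels are permuted by each adjacency independently of the flag, so an
    automorphism fixing one label fixes all of them; commuting with the
    adjacencies between the three copies of a flag, it acts on each copy
    by the same automorphism of [M]. *)
Lemma meets_same x y j : meets x j y j <-> same_orbit x y.
Proof.
have labelP (phi : Tr M -> Tr M) : automorphism phi -> (phi (x, j)).2 = j ->
    forall z, (phi z).2 = z.2.
  move=> [_ phiE] phix; apply: (flag_ind (x := (x, j) : Tr M)) => // i z zE.
  by rewrite phiE !trunc_adj_label zE.
split=> [[phi phiA phix]|[g [[h gK hK] gE] ->]]; last first.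
  exists (fun z : Tr M => (g z.1, z.2) : Tr M) => //; split.
    by exists (fun z : Tr M => (h z.1, z.2) : Tr M) => -[u l] /=;
       rewrite ?gK ?hK.
  by move=> i [u l]; elim/ord3P: i; elim/ord3P: l => /=; rewrite ?gE.
have phil := labelP _ phiA (esym (congr1 snd phix)).
case: phiA => [[psi phiK psiK] phiE].
pose g u := (phi (u, o0)).1.
have phi0 u : phi (u, o0) = (g u, o0).
  by rewrite [LHS]surjective_pairing phil.
(* adj o2 joins (u, 0) to (u, 2), and adj o1 joins (u, 2) to (u, 1) *)
have phi2 u : phi (u, o2) = (g u, o2) by have := phiE o2 (u, o0); rewrite phi0.
have phi1 u : phi (u, o1) = (g u, o1) by have := phiE o1 (u, o2); rewrite phi2.
have phig u l : phi (u, l) = (g u, l) by elim/ord3P: l.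
have psil z : (psi z).2 = z.2 by rewrite -{2}(psiK z) phil.
have psi0 u : psi (u, o0) = ((psi (u, o0)).1, o0).
  by rewrite [LHS]surjective_pairing psil.
exists g; last by move: phix; rewrite phig => -[].
split=> [|i u].
  exists (fun u => (psi (u, o0)).1) => u; first by rewrite -phi0 phiK.
  by rewrite /g -psi0 psiK.
(* s_0, s_1, s_2 are seen in Tr M as r_0 on label 1, and r_0, r_1 on label 0 *)
have := phiE o0 (u, o1); have := phiE o0 (u, o0); have := phiE o1 (u, o0).
by rewrite /= !phig /=; elim/ord3P: i => -[E2] [E1] [E0].
Qed.

Definition labels z : {set 'I_3} :=
  [set k | `[< exists y, same_orbit z ((y, k) : Tr M) >]].

Lemma labelsP z k :
  reflect (exists y, same_orbit z ((y, k) : Tr M)) (k \in labels z).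
Proof. by rewrite inE; apply: asboolP. Qed.

Lemma labels_same z z' : same_orbit z z' -> labels z = labels z'.
Proof.
move=> zz'; apply/setP => k; apply/labelsP/labelsP => -[y zy]; exists y.
  exact: same_trans (same_sym zz') zy.
exact: same_trans zz' zy.
Qed.

Lemma labels_adj i z k : (relabel i k \in labels (adj i z)) = (k \in labels z).
Proof.
have sub l w : l \in labels w -> relabel i l \in labels (adj i w).
  move=> /labelsP [y wy]; apply/labelsP.
  exists (adj i ((y, l) : Tr M)).1; apply: same_trans (same_adj i wy) _.
  rewrite [X in same_orbit X]surjective_pairing trunc_adj_label.
  exact: same_refl.
by apply/idP/idP => [/sub|/sub //]; rewrite relabelK adjK.
Qed.

Lemma card_labels_adj i z : #|labels (adj i z)| = #|labels z|.
Proof.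
rewrite -[RHS](card_imset _ (inv_inj (relabelK i))); apply: eq_card => k.
apply/idP/imsetP => [kz|[l lz ->]]; last by rewrite labels_adj.
exists (relabel i k); last by rewrite relabelK.
by rewrite -(adjK i z) labels_adj.
Qed.

End TruncationOrbits.

(** Double counting of the pairs of an orbit of [Tr M] and a label on it: each
    label occurs on as many orbits as [M] has, by [meets_same], and each orbit
    has the same number of labels, by connectedness. *)
Lemma labels_count (M : surface_map) k l (z : Tr M) :
  orbit_map k M -> orbit_map l (Tr M) -> l * #|labels z| = 3 * k.
Proof.
move=> /orbit_numbering [cl clP clO] /orbit_numbering [cl' cl'P cl'O].
have [rep repK] := choice clO; have [rep' rep'K] := choice cl'O.
have cardE (w : Tr M) : #|labels w| = #|labels z|.
  apply: (flag_ind (P := fun w => #|labels w| = #|labels z|) (x := z)) => //.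
  by move=> i y <-; exact: card_labels_adj.
have fiber j : \sum_(o < l) (j \in labels (rep' o)) = k.
  have inj : injective (fun d => cl' (rep d, j)).
    by move=> c d /cl'P /meets_same /clP; rewrite !repK.
  rewrite -[RHS]card_ord -[RHS](card_imset _ inj) -[RHS]sum1_card [RHS]big_mkcond.
  apply: eq_bigr => o _.
  suff -> : (j \in labels (rep' o)) =
            (o \in imset (fun d => cl' (rep d, j)) (mem 'I_k)).
    by case: (o \in _).
  apply/labelsP/imsetP => [[y oy]|[d _ ->]].
    exists (cl y) => //; rewrite -{1}(rep'K o); apply/cl'P.
    apply: same_trans oy _; apply/meets_same/clP.
    by rewrite repK.
  by exists (rep d); apply/cl'P; rewrite rep'K.
have -> : l * #|labels z| = \sum_(o < l) #|labels (rep' o)|.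
  by rewrite (eq_bigr _ (fun o _ => cardE _)) sum_nat_const card_ord.
under eq_bigr do rewrite -sum1_card big_mkcond /=.
rewrite exchange_big /= (eq_bigr (fun=> k)) ?sum_nat_const ?card_ord // => j _.
by rewrite -[RHS](fiber j); apply: eq_bigr => o _; case: (j \in _).
Qed.

(** * The half of the flags that pairs label 0 with label 1 *)

Lemma pair3 (L : {set 'I_3}) :
  #|L| = 2 -> o0 \in L -> (o2 \in L) = (o1 \notin L).
Proof.
rewrite (cardsD1 o0) (cardsD1 o1) (cardsD1 o2).
have -> : L :\ o0 :\ o1 :\ o2 = finset.set0.
  by apply/setP; apply: ord3P; rewrite !inE.
by rewrite cards0 !inE /=; do 3?case: (_ \in L).
Qed.

Section TwoLabels.
Variable M : surface_map.
Hypothesis labels2 : forall z : Tr M, #|labels z| = 2.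
Implicit Types x y : M.

(** Label 1 of the truncation lies along the original edges. *)
Definition edge_half x : bool := o1 \in labels ((x, o0) : Tr M).

Lemma label_self z : z.2 \in labels (z : Tr M).
Proof.
by apply/labelsP; exists z.1; case: z => x j; apply: same_refl.
Qed.

Lemma edge_halfC x : (o2 \in labels ((x, o0) : Tr M)) = ~~ edge_half x.
Proof.
by apply: pair3; [exact: labels2 | exact: (label_self ((x, o0) : Tr M))].
Qed.

(** Moving from [(x, 0)] to [(x, 1)] through [(x, 2)] turns the label set
    {0, 1} into {1, 2}; this is what makes [edge_half] invariant under s_0,
    which [Tr M] only sees on label 1. *)
Lemma edge_half_edge x : (o2 \in labels ((x, o1) : Tr M)) = edge_half x.
Proof.
rewrite (labels_adj o1 ((x, o2) : Tr M) o1 : (o2 \in labels ((x, o1) : Tr M)) = _).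
exact: (labels_adj o2 ((x, o0) : Tr M) o1).
Qed.

Lemma edge_half_same x y : same_orbit x y -> edge_half x = edge_half y.
Proof. by move=> /(meets_same _ _ o0) /labels_same xy; rewrite /edge_half xy. Qed.

Lemma edge_half_adj0 x : edge_half (adj o0 x) = edge_half x.
Proof.
by rewrite -!edge_half_edge; exact: (labels_adj o0 ((x, o1) : Tr M) o2).
Qed.

Lemma edge_half_adj1 x : edge_half (adj o1 x) = edge_half x.
Proof. exact: (labels_adj o0 ((x, o0) : Tr M) o1). Qed.

Lemma edge_half_adj2 x : edge_half (adj o2 x) = ~~ edge_half x.
Proof. by rewrite -edge_halfC; exact: (labels_adj o1 ((x, o0) : Tr M) o2). Qed.

(** For [x] in the half, a [z] such that [(x, 0)] meets [(z, 1)] lies outside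
    the half, because inside it the flags labelled 1 have label set {1, 2}.  The
    twist by s_2 brings the partner back into the half and makes the relation
    symmetric. *)
Definition partner x y : Prop := meets x o0 (adj o2 y) o1.

Lemma edge_half_partner x :
  edge_half x -> exists2 y, edge_half y & partner x y.
Proof.
move=> hx; have /labelsP [y xy] := hx.
exists (adj o2 y); last by rewrite /partner /meets adjK.
by rewrite edge_half_adj2 -edge_half_edge -(labels_same xy) edge_halfC hx.
Qed.

Lemma partner_adj2 x y : partner x y -> meets (adj o2 x) o0 (adj o2 y) o2.
Proof. exact: (same_adj o1). Qed.

Lemma partner_edge x y : partner x y -> meets x o2 y o1.
Proof. by move=> /(same_adj o2); rewrite /= adjK. Qed.

Lemma partner_face x y : partner x y -> meets (adj o2 x) o2 (adj o2 y) o0.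
Proof. by move=> /partner_adj2 /(same_adj o2). Qed.

(** [partner x y] transports along r_1, r_2, r_1 to its own converse: the labels
    (0, 1) become (0, 2), (2, 0), (1, 0). *)
Lemma partner_sym x y : partner x y -> partner y x.
Proof. by move=> /partner_face /(same_adj o1) /same_sym /=; rewrite adjK. Qed.

(** The face of [Tr M] at a vertex of [M] (label 0) has s_1 as r_0, an
    edge side (label 1) has s_0; a partner pair exchanges them. *)
Lemma partner_adj01 x y : partner x y -> partner (adj o1 x) (adj o0 y).
Proof. by move=> /(same_adj o0) /=; rewrite -adj02C. Qed.

Lemma partner_adj212 x y : partner x y ->
  partner (adj o2 (adj o1 (adj o2 x))) (adj o2 (adj o1 (adj o2 y))).
Proof.
move=> /partner_adj2 /(same_adj o0) /= xy; rewrite /partner adjK.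
exact: (same_adj o1 xy).
Qed.

Lemma partner_same x y y' : partner x y -> partner x y' -> same_orbit y y'.
Proof.
move=> xy xy'; rewrite -(adjK o2 y) -(adjK o2 y'); apply: same_adj.
by apply/(meets_same _ _ o1); exact: same_trans (same_sym xy) xy'.
Qed.

Lemma partner_congr x x' y y' :
  partner x y -> same_orbit x x' -> same_orbit y y' -> partner x' y'.
Proof.
move=> xy /(meets_same _ _ o0) xx' /(same_adj o2) /(meets_same _ _ o1) yy'.
exact: same_trans (same_sym xx') (same_trans xy yy').
Qed.

(** The adjacency s_2 exchanges the half with its complement, so each contains
    half of the orbits. *)
Lemma edge_half_representatives k : orbit_map k.*2 M ->
  exists (T : finType) (e : T -> M), [/\ #|T| = k, forall u, edge_half (e u),
    forall x, edge_half x -> exists u, same_orbit x (e u) &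
    forall u v, same_orbit (e u) (e v) -> u = v].
Proof.
move=> /orbit_numbering [cl clP clO]; have [rep repK] := choice clO.
have repE x : same_orbit (rep (cl x)) x by apply/clP; rewrite repK.
pose D := [set d | edge_half (rep d)].
pose h d := cl (adj o2 (rep d)).
have hK : involutive h.
  move=> d; rewrite -[RHS](repK d); apply/clP.
  by rewrite -[X in same_orbit _ X](adjK o2); apply/same_adj/repE.
have hD : h @: D = ~: D.
  have hC d : (h d \in D) = (d \notin D).
    by rewrite !inE (edge_half_same (repE _)) edge_half_adj2.
  apply/setP => d; rewrite inE -hC; apply/imsetP/idP => [[c cD ->]|dD].
    by rewrite hK.
  by exists (h d); rewrite ?hK.
have Dk : #|D| = k.
  have := cardsC D; rewrite -hD card_imset; last exact: inv_inj hK.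
  by rewrite card_ord addnn => /double_inj.
exists {d | d \in D}, (fun u => rep (val u)); split=> [|u|x hx|u v].
- by rewrite card_sig -[RHS]Dk; apply: eq_card => d; rewrite inE.
- by have := valP u; rewrite inE.
- have xD : cl x \in D by rewrite inE (edge_half_same (repE x)).
  by exists (Sub (cl x) xD); rewrite SubK; apply/same_sym/repE.
- by move=> /clP; rewrite !repK => /val_inj.
Qed.

End TwoLabels.

(** * Involutions of a three-element set *)

Definition exchanges (T : Type) (f : T -> T) (p q r : T) : Prop :=
  [/\ f p = q, f q = p & f r = r].

Section ThreePoints.
Variable T : finType.
Hypothesis T3 : #|T| = 3.

Lemma three_third (p q : T) : p != q -> exists r, p != r /\ q != r.
Proof.
move=> pq; have : 0 < #|~: [set p; q]|.
  by rewrite -(ltn_add2l #|[set p; q]|) cardsC T3 cards2 pq.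
by move=> /card_gt0P [r]; rewrite !inE negb_or => /andP [rp rq]; exists r;
   rewrite ![_ == r]eq_sym.
Qed.

Lemma three_cover (p q r : T) : p != q -> p != r -> q != r ->
  forall x, [\/ x = p, x = q | x = r].
Proof.
move=> pq pr qr x; have /eqP E : [set p; q; r] == [set: T].
  rewrite eqEcard finset.subsetT cardsT T3 finset.setUC cardsU1 cards2 !inE.
  by rewrite negb_or ![r == _]eq_sym pr qr pq.
have : x \in [set p; q; r] by rewrite E inE.
by rewrite !inE => /orP[/orP[]|] /eqP; [constructor 1|constructor 2|constructor 3].
Qed.

Lemma involution_exchanges (f : T -> T) (p q r : T) : involutive f ->
  f p = q -> p != q -> p != r -> q != r -> exchanges f p q r.
Proof.
move=> fK fp pq pr qr; have fq : f q = p by rewrite -fp fK.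
split=> //; case: (three_cover pq pr qr (f r)) => // E.
  by move: qr; rewrite -(fK r) E fp eqxx.
by move: pr; rewrite -(fK r) E fq eqxx.
Qed.

Variables a b t be : T -> T.
Hypotheses (aK : involutive a) (tK : involutive t) (beK : involutive be).
Hypothesis be_b : forall u, be (b u) = a (be u).
Hypothesis be_t : forall u, be (t u) = t (be u).
Hypothesis trans : forall P : pred T,
  (forall u, P u -> [&& P (a u), P (b u) & P (t u)]) ->
  forall u v, P u -> P v.

(** When [be] swaps [p] and [q], the point [r] it fixes is also fixed by [t];
    transitivity then requires [a] to move [r], and [p] may be chosen as its
    image.  When [be] is trivial, [a] and [b] coincide and transitivity requires
    [a] and [t] to be distinct transpositions; [p] is the point they share. *)
Lemma three_points :
  exists p q r : T,
    [/\ exchanges be p q r, exchanges a p r q, exchanges b q r p &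
        t =1 id \/ exchanges t p q r] \/
    [/\ be =1 id, exchanges a p q r, exchanges b p q r & exchanges t p r q].
Proof.
have bE u : b u = be (a (be u)) by rewrite -be_b beK.
have no_fixed r : a r = r -> b r = r -> t r = r -> False.
  move=> ar br tr.
  have E u : u = r.
    by apply/eqP; apply: (trans (P := pred1 r) _ (u := r)) => //= v /eqP ->;
       rewrite ar br tr eqxx.
  have /subset_leq_card : [set: T] \subset [set r].
    by apply/fintype.subsetP => u _; rewrite inE (E u).
  by rewrite cardsT T3 cards1.
have [/existsP [p0 pq0]|/existsPn be1] := boolP [exists p, p != be p].
  have [r [pr0 qr0]] := three_third pq0.
  have [_ beq0 ber] := involution_exchanges beK erefl pq0 pr0 qr0.
  have tr : t r = r.
    have [E|E|//] := three_cover pq0 pr0 qr0 (t r);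
      have := be_t r; rewrite ber E ?beq0 => F; move: pq0.
      by rewrite F eqxx.
    by rewrite -F eqxx.
  have ar : a r <> r.
    by move=> ar; apply: (no_fixed r); rewrite // bE ber ar ber.
  have [p [q [arp bep pq pr qr]]] : exists p q,
      [/\ a r = p, be p = q, p != q, p != r & q != r].
    have [E|E|//] := three_cover pq0 pr0 qr0 (a r); first by exists p0, (be p0).
    by exists (be p0), p0; rewrite eq_sym.
  have [_ beq _] := involution_exchanges beK bep pq pr qr.
  have ap : a p = r by rewrite -arp aK.
  have [qp rq rp] : [/\ q != p, r != q & r != p].
    by rewrite ![_ == p]eq_sym [r == q]eq_sym.
  have aE : exchanges a p r q by exact: involution_exchanges.
  have bq : b q = r by rewrite bE beq ap ber.
  have bK : involutive b by move=> u; rewrite !bE beK aK beK.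
  exists p, q, r; left; split=> //; try exact: involution_exchanges.
  have [tp|tp|tp] := three_cover pq pr qr (t p).
  - left=> x; have [->|->|->] //= := three_cover pq pr qr x.
    by rewrite -bep -be_t tp.
  - by right; exact: involution_exchanges.
  - by move: pr; rewrite -tr -tp tK eqxx.
have beE u : be u = u by apply/esym/eqP/negPn/be1.
have {}bE u : b u = a u by rewrite bE !beE.
have [p pq] : exists p, p != a p.
  have [/existsP //|/existsPn a1] := boolP [exists p, p != a p].
  have aE u : a u = u by apply/esym/eqP/negPn/a1.
  have /card_gt0P [u _] : 0 < #|T| by rewrite T3.
  have sub : [set: T] \subset [set u; t u].
    apply/fintype.subsetP => v _.
    apply: (trans (P := [pred w in [set u; t u]]) _ (u := u)); last first.
      by rewrite !inE eqxx.
    move=> w; rewrite bE aE !inE => /orP[] /eqP ->; rewrite ?tK !eqxx ?orbT //.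
  by have := subset_leq_card sub; rewrite cardsT T3 cards2; case: (_ != _).
have [r [pr qr]] := three_third pq.
have aE := involution_exchanges aK erefl pq pr qr.
have [_ aq ar] := aE.
have tr : t r <> r by move=> tr; apply: (no_fixed r) => //; rewrite bE.
have [p' [q' [ap pq' pr' qr' tp]]] : exists p' q',
    [/\ a p' = q', p' != q', p' != r, q' != r & t p' = r].
  have [E|E|//] := three_cover pq pr qr (t r).
    by exists p, (a p); split=> //; rewrite -E tK.
  by exists (a p), p; split=> //; [rewrite eq_sym | rewrite -E tK].
exists p', q', r; right; split=> //; try exact: involution_exchanges.
- by case: (involution_exchanges aK ap pq' pr' qr') => *; split; rewrite bE.
- by apply: involution_exchanges; rewrite // eq_sym.
Qed.

End ThreePoints.

(** * The two orbit graphs, reconstructed from edge_half of the flags *)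

Section Models.
Variables (T : Type) (a b t be : T -> T).

(** A point is a representative in the half (second half for [true], reached by
    s_2); s_1 on the second half is [t] transported by s_2. *)
Definition map_act (i : 'I_3) (z : bool * T) : bool * T :=
  let: (c, u) := z in
  match val i, c with
  | 0, _ => (c, a u)
  | 1, false => (c, b u)
  | 1, true => (c, t u)
  | _, _ => (~~ c, u)
  end.

(** Each orbit of [Tr M] is named once, by its label pair: {0, 1} for index 0,
    {0, 2} for index 1, {1, 2} for index 2.  The map [be] enters whenever an
    adjacency leaves the chosen representatives. *)
Definition trunc_act (i : 'I_3) (z : 'I_3 * T) : 'I_3 * T :=
  let: (c, u) := z in
  match val c, val i with
  | 0, 0 => (o0, b u) | 0, 1 => (o1, u) | 0, _ => (o2, be u)
  | 1, 0 => (o1, t u) | 1, 1 => (o0, u) | 1, _ => (o1, be u)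
  | _, 0 => (o2, a u) | _, 1 => (o2, be u) | _, _ => (o0, be u)
  end.

Variables (M : surface_map) (e : T -> M).

Definition map_flag (z : bool * T) : M :=
  if z.1 then adj o2 (e z.2) else e z.2.

Definition trunc_flag (z : 'I_3 * T) : Tr M :=
  match val z.1 with
  | 0 => (e z.2, o0) | 1 => (adj o2 (e z.2), o0) | _ => (e z.2, o1)
  end.

Hypothesis aE : forall u, same_orbit (adj o0 (e u)) (e (a u)).
Hypothesis bE : forall u, same_orbit (adj o1 (e u)) (e (b u)).
Hypothesis tE : forall u, same_orbit (adj o2 (adj o1 (adj o2 (e u)))) (e (t u)).
Hypothesis beE : forall u, partner (e u) (e (be u)).

Lemma adj_map_flag i z :
  same_orbit (adj i (map_flag z)) (map_flag (map_act i z)).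
Proof.
case: z => c u; elim/ord3P: i; case: c; rewrite /map_flag /=.
- by rewrite -adj02C; apply/same_adj/aE.
- exact: aE.
- by rewrite -[X in same_orbit X](adjK o2); apply/same_adj/tE.
- exact: bE.
- by rewrite adjK; apply: same_refl.
- exact: same_refl.
Qed.

Lemma adj_trunc_flag i z :
  same_orbit (adj i (trunc_flag z)) (trunc_flag (trunc_act i z)).
Proof.
case: z => c u; elim/ord3P: c; elim/ord3P: i; rewrite /trunc_flag /=.
- exact/meets_same/bE.
- exact: same_refl.
- exact: partner_edge (beE u).
- apply/meets_same; rewrite -[X in same_orbit X](adjK o2).
  exact/same_adj/tE.
- by rewrite adjK; apply: same_refl.
- exact: partner_face (beE u).
- exact/meets_same/aE.
- exact: partner_edge (beE u).
- exact/same_sym/partner_sym/beE.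
Qed.

End Models.

Theorem proposition9 (M : surface_map) (hM : orbit_map 6 M)
    (hTr : orbit_map 9 (Tr M)) :
  (of_type M type6_D /\ of_type (Tr M) type9_A) \/
  (of_type M type6_F /\ of_type (Tr M) type9_B) \/
  (of_type M type6_Mopp /\ of_type (Tr M) type9_Cd).
Proof.
have labels2 (z : Tr M) : #|labels z| = 2.
  by apply/eqP; rewrite -(eqn_pmul2l (isT : 0 < 9)) (labels_count z hM hTr).
have [T [e [T3 he eP eI]]] :=
  edge_half_representatives labels2 (hM : orbit_map 3.*2 M).
have half_choice (f : M -> M) : (forall x, edge_half (f x) = edge_half x) ->
    exists g : T -> T, forall u, same_orbit (f (e u)) (e (g u)).
  move=> hf; have /choice[g gE] : forall u, exists v, same_orbit (f (e u)) (e v).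
    by move=> u; apply: eP; rewrite hf.
  by exists g.
have [a aE] := half_choice _ (edge_half_adj0 (M := M)).
have [b bE] := half_choice _ (edge_half_adj1 (M := M)).
have half212 (x : M) : edge_half (adj o2 (adj o1 (adj o2 x))) = edge_half x.
  by rewrite (edge_half_adj2 labels2) edge_half_adj1 (edge_half_adj2 labels2) negbK.
have [t tE] := half_choice _ half212.
have /choice [be beE] : forall u, exists v, partner (e u) (e v).
  move=> u; have [y hy uy] := edge_half_partner labels2 (he u).
  have [v yv] := eP _ hy; exists v.
  exact: partner_congr uy (same_refl _) yv.
have aK : involutive a.
  move=> u; apply/eI/same_sym; rewrite -{1}(adjK o0 (e u)).
  exact: same_trans (same_adj o0 (aE u)) (aE _).
have tK : involutive t.
  move=> u; apply/eI/same_sym.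
  have := same_adj o2 (same_adj o1 (same_adj o2 (tE u))); rewrite !adjK => E.
  exact: same_trans E (tE _).
have beK : involutive be.
  by move=> u; apply/eI/(partner_same (beE (be u)))/partner_sym.
have be_b u : be (b u) = a (be u).
  apply/eI/(partner_same (beE (b u))).
  exact: partner_congr (partner_adj01 (beE u)) (bE u) (aE _).
have be_t u : be (t u) = t (be u).
  apply/eI/(partner_same (beE (t u))).
  exact: partner_congr (partner_adj212 (beE u)) (tE u) (tE _).
(* s_2 only changes the half, so any set of points closed under a, b, t gives
   a set of flags closed under the adjacencies *)
have trans (P : pred T) : (forall u, P u -> [&& P (a u), P (b u) & P (t u)]) ->
    forall u v, P u -> P v.
  move=> Pabt u v Pu.
  have [[c w] Pw vw] : exists2 z, P z.2 & same_orbit (e v) (map_flag e z).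
    move: (e v); apply: (flag_ind (x := e u)).
      by exists (false, u) => //; exact: same_refl.
    move=> i y [z Pz yz]; exists (map_act a b t i z).
      case: z Pz {yz} => c w /= Pw; have /and3P[Pa Pb Pt] := Pabt _ Pw.
      by elim/ord3P: i; case: c.
    exact: same_trans (same_adj i yz) (adj_map_flag aE bE tE i z).
  case: c Pw vw => /= Pw vw; last by rewrite (eI _ _ vw).
  by have := edge_half_same vw; rewrite /map_flag /= (edge_half_adj2 labels2) !he.
have typeM := of_type_model hM (adj_map_flag aE bE tE).
have typeTr := of_type_model hTr (adj_trunc_flag aE bE tE beE).
have [p [q [r pqr]]] := three_points T3 aK tK beK be_b be_t trans.
case: pqr => [[[bep beq ber] [ap ar aq] [bq br bp] tpqr]|].
  (* Numbering for 9_A: the orbit of (1, r) is an end of the graph, adjacent only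
     to (0, r), and is number 9; the rest follows along the edges.  In 9_Cd only
     the edge t between numbers 3 and 4 is added. *)
  pose zs := [:: (o2, p); (o0, q); (o1, q); (o1, p); (o0, p); (o2, q);
                 (o2, r); (o0, r); (o1, r)].
  case: tpqr => [t1|[tp tq tr]]; [left | right; right]; split.
  - apply: (typeM (false, p)
             [:: (false, p); (false, q); (false, r); (true, p); (true, q);
                 (true, r)]) => //.
    by apply: ord3P; rewrite /= ?(ap, aq, ar, bp, bq, br, t1).
  - apply: (typeTr (o0, p) zs) => //.
    by apply: ord3P; rewrite /= ?(ap, aq, ar, bp, bq, br, t1, bep, beq, ber).
  - apply: (typeM (false, p)
             [:: (false, p); (false, q); (false, r); (true, r); (true, q);
                 (true, p)]) => //.
    by apply: ord3P; rewrite /= ?(ap, aq, ar, bp, bq, br, tp, tq, tr).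
  - apply: (typeTr (o0, p) zs) => //.
    by apply: ord3P;
       rewrite /= ?(ap, aq, ar, bp, bq, br, tp, tq, tr, bep, beq, ber).
(* In 9_B, with be trivial, r_2 and r_1 join each triple (2, u), (0, u), (1, u). *)
move=> [be1 [ap aq ar] [bp bq br] [tp tr tq]]; right; left; split.
- apply: (typeM (false, p)
           [:: (true, q); (true, p); (true, r); (false, r); (false, q);
               (false, p)]) => //.
  by apply: ord3P; rewrite /= ?(ap, aq, ar, bp, bq, br, tp, tq, tr).
- apply: (typeTr (o0, p)
           [:: (o2, r); (o0, r); (o1, r); (o2, p); (o0, p); (o1, p);
               (o2, q); (o0, q); (o1, q)]) => //.
  by apply: ord3P; rewrite /= ?(ap, aq, ar, bp, bq, br, tp, tq, tr, be1).
Qed.
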